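(* For every integer $k\geq 2$, we have $g^k_2(5)=2^k+1$.
   Context: A Gallai-$k$-coloring of the complete graph $K_n$ is a map $c:E(K_n)\to\{1,\dots,k\}$ (not necessarily surjective) with no rainbow triangle, i.e. every triangle receives at most two distinct colors. For integers $k\ge 1$ and $1\le q\le \binom{p}{2}$, $g^k_q(p)$ denotes the smallest positive integer $n$ such that every Gallai-$k$-coloring of $K_n$ contains a copy of $K_p$ whose edges receive at most $q$ distinct colors. *)

(* Defs.v *)
From mathcomp Require Import all_boot.

Set Implicit Arguments.
Unset Strict Implicit.
Unset Printing Implicit Defensive.

(* The edge set of the complete graph K_n on the vertex set 'I_n. *)
Definition edge (n : nat) : finType := {e : {set 'I_n} | #|e| == 2}.

(* The colors received by the complete subgraph of K_n induced on A. *)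
Definition colors_on (n k : nat) (c : edge n -> 'I_k) (A : {set 'I_n}) :
    {set 'I_k} :=
  [set c e | e : edge n & val e \subset A].

Definition gallai_coloring (n k : nat) (c : edge n -> 'I_k) : Prop :=
  forall T : {set 'I_n}, #|T| = 3 -> #|colors_on c T| <= 2.

(* Copies of K_p in K_n correspond to the p-subsets of the vertex set. *)
Definition gallai_arrow (k q p n : nat) : Prop :=
  forall c : edge n -> 'I_k, gallai_coloring c ->
    exists A : {set 'I_n}, #|A| = p /\ #|colors_on c A| <= q.

(* [gallai_number k q p g] reads g^k_q(p) = g; in particular it asserts that
   the minimum exists. *)
Definition gallai_number (k q p g : nat) : Prop :=
  [/\ 0 < g, gallai_arrow k q p g &
      forall n, 0 < n -> gallai_arrow k q p n -> g <= n].

Lemma gallai_number_unique (k q p g1 g2 : nat) :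
  gallai_number k q p g1 -> gallai_number k q p g2 -> g1 = g2.
Proof.
move=> [g1_gt0 a1 min1] [g2_gt0 a2 min2].
by apply/eqP; rewrite eqn_leq min1 ?min2.
Qed.

(* Main.v *)
Require Import Defs.
From mathcomp Require Import all_boot.
From mathcomp Require Import zify.

Set Implicit Arguments.
Unset Strict Implicit.
Unset Printing Implicit Defensive.

(** The lower bound: index at most [2 ^ k] vertices by distinct words of [k]
    bits and color an edge with the first position where the words of its ends
    differ. Three distinct colors on a triangle are impossible, since at the
    smallest of them the three words would show only one pair that differs.
    Two vertices joined by an edge of color [p] or [q] differ at position [p]
    or at position [q], so a set carrying only these two colors injects into
    pairs of bits and has at most four vertices ([bit_coloring]).

    The upper bound: arrange the [k] colors in a cycle, and let bag [f] consist
    of the two cyclically consecutive colors [f - 1] and [f]. Each color lies in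
    exactly two bags. Writing [omega f] for the largest size of a clique whose
    colors lie in bag [f], the claim is that a Gallai coloring of [n] vertices
    in which no five vertices carry at most two colors satisfies
      [n ^ 2 <= prod_f omega f].
    As every bag has two colors, [omega f <= 4], and the right-hand side is at
    most [4 ^ k], so that [n <= 2 ^ k].

    The claim is proved in a weighted form ([bounded]), because that form is
    stable under substitution: if all vertices of a set [C] look the same from
    each outside vertex (a module), replace [C] by one of its vertices, whose
    weight in bag [f] becomes the maximum weight of a clique inside [C]
    ([module_bounded]). This leaves the colorings without proper modules.
    Gallai's theorem says that a coloring with at least three colors has a
    disconnected color class, whose components are modules
    ([rainbow_free_disconnected], [three_colors_decomposable]). With at most two
    colors there are at most four vertices, and the only indecomposable
    colorings are single vertices, single edges and the path on four vertices
    together with its complement ([decomposable_or_path4]).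

    For these, split off two disjoint families of bags, each of which satisfies
      [sum_v prod_f w v f <= prod_f omega f]
    and conclude by the Cauchy-Schwarz inequality ([bounded_balanced]). A single
    color provides its two bags. On the path, a bag of the path color and a bag
    of the complementary color together satisfy this inequality: it is the
    weighted perfectness of the path ([path4_perfect]). *)

(** * Auxiliary facts on finite sets and on sums *)

Lemma subset_pair (K : finType) (x0 : K) (S : {set K}) : #|S| <= 2 ->
  exists p q, S \subset [set p; q].
Proof.
move=> S2; have [->|[a aS]] := set_0Vmem S.
  by exists x0, x0; rewrite sub0set.
have [S0|[b bS]] := set_0Vmem (S :\ a).
  by exists a, a; rewrite setUid -setD_eq0 S0.
exists a, b; rewrite -(setD1K aS) setUS // -(setD1K bS) subUset subxx /=.
have /eqP/cards0_eq-> : #|S :\ a :\ b| == 0; last exact: sub0set.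
by have := cardsD1 a S; have := cardsD1 b (S :\ a); rewrite aS bS; lia.
Qed.

Lemma cards3_set (T : finType) (A : {set T}) : #|A| = 3 ->
  exists x y z, [/\ A = [set x; y; z], x != y, y != z & x != z].
Proof.
move=> A3; have: 2 < #|A| by rewrite A3.
case/card_gt2P=> x [y [z [[xA yA zA] [xy yz zx]]]].
exists x, y, z; split; rewrite // 1?eq_sym //.
apply/esym/eqP; rewrite eqEcard A3 !subUset !sub1set xA yA zA /=.
by rewrite setUC cardsU1 !inE cards2 negb_or zx xy eq_sym yz.
Qed.

(** The mixed term satisfies [(m * n) ^ 2 <= M ^ 2 * (a * t) * (s * b)], which
    the inequality between arithmetic and geometric means compares with
    [a * t + s * b]. *)
Lemma leq_mul_sum_sq m n M a b s t :
  m ^ 2 <= M * (a * b) -> n ^ 2 <= M * (s * t) ->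
  (m + n) ^ 2 <= M * ((a + s) * (b + t)).
Proof.
move=> hm hn.
have cross : 2 * (m * n) <= M * (a * t + s * b).
  rewrite -leq_sqr.
  have -> : (2 * (m * n)) ^ 2 = 4 * (m ^ 2 * n ^ 2) by nia.
  apply: (@leq_trans (4 * ((M * (a * b)) * (M * (s * t))))).
    by rewrite leq_mul2l leq_mul.
  have -> : 4 * ((M * (a * b)) * (M * (s * t))) =
      M ^ 2 * (4 * ((a * t) * (s * b))) by nia.
  by rewrite expnMn leq_mul2l nat_AGM2 orbT.
by rewrite sqrnD; nia.
Qed.

(** The Cauchy-Schwarz inequality, with squares in place of square roots so
    that everything stays in [nat]. *)
Lemma cauchy_schwarz_sum (I : finType) (P : {set I}) (n a b : I -> nat) M :
  (forall v, v \in P -> n v ^ 2 <= M * (a v * b v)) ->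
  (\sum_(v in P) n v) ^ 2 <=
    M * ((\sum_(v in P) a v) * (\sum_(v in P) b v)).
Proof.
move=> h; apply: (big_ind3 (fun u v w => u ^ 2 <= M * (v * w))) => //.
by move=> *; apply: leq_mul_sum_sq.
Qed.

(** Weights [x] on the path [a - b - c - d] and [y] on its complement
    [c - a - d - b]: the sum of the products is at most the product of the
    maximum clique weights, as for every perfect graph. *)
Lemma path4_perfect xa xb xc xd ya yb yc yd X Y :
  xa + xb <= X -> xb + xc <= X -> xc + xd <= X ->
  ya + yc <= Y -> ya + yd <= Y -> yb + yd <= Y ->
  xa * ya + xb * yb + xc * yc + xd * yd <= X * Y.
Proof.
move=> ab bc cd ac ad bd.
have h1 : xa * ya + xb * yb + xc * yc + xd * yd <=
   (X - xb) * ya + xb * (Y - yd) + xc * (Y - ya) + (X - xc) * yd.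
  by rewrite !leq_add // leq_mul //; lia.
(* With [s = ya + yd], the sum in [h1] equals [X * s + (xb + xc) * (Y - s)],
   where [s <= Y] and [xb + xc <= X]. *)
by apply: leq_trans h1 _; nia.
Qed.

(** * Gallai's theorem: colorings with three colors have modules *)

Section Coloring.

Variables (T K : finType) (col : T -> T -> K).
Hypothesis col_sym : forall x y, col x y = col y x.
Implicit Types (A B C : {set T}) (x y z : T) (i : K).

Definition rainbow_free := forall x y z : T,
  x != y -> y != z -> x != z ->
  [\/ col x y = col y z, col x y = col x z | col y z = col x z].

Definition color_edge (A : {set T}) (i : K) : rel T :=
  [rel x y | [&& x \in A, y \in A, x != y & col x y == i]].

Lemma color_edgeE A i x y :
  color_edge A i x y = [&& x \in A, y \in A, x != y & col x y == i].
Proof. by []. Qed.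

Lemma color_edge_sym A i : symmetric (color_edge A i).
Proof. by move=> x y; rewrite !color_edgeE eq_sym col_sym andbCA. Qed.

Definition used (A : {set T}) : {set K} :=
  [set i | [exists x, exists y, color_edge A i x y]].

Lemma usedP (A : {set T}) i :
  reflect (exists x y, color_edge A i x y) (i \in used A).
Proof.
rewrite inE; apply: (iffP existsP) => [[x /existsP[y e]]|[x [y e]]].
  by exists x, y.
by exists x; apply/existsP; exists y.
Qed.

Lemma connect_color_sym A i : connect_sym (color_edge A i).
Proof. exact/sym_connect_sym/color_edge_sym. Qed.

Lemma connect_color_in A i x y :
  connect (color_edge A i) x y -> (x \in A) = (y \in A).
Proof.
by apply: closed_connect => u v /and4P[-> ->].
Qed.

(** Two adjacent vertices in one component of color [i] see a vertex [z] of
    another component in the same color, since the triangle they form with [z]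
    has exactly one edge of color [i]. Hence every component is a module. *)
Lemma connect_color_uniform A i x y z : rainbow_free ->
  x \in A -> z \in A -> connect (color_edge A i) x y ->
  ~~ connect (color_edge A i) x z -> col x z = col y z.
Proof.
move=> rf xA zA /connectP[p + ->] {y}.
elim: p x xA => //= x1 p IH x xA /andP[e ep] nxz.
have nx1z: ~~ connect (color_edge A i) x1 z.
  by apply: contra nxz; apply: connect_trans; apply: connect1.
have outside u : u \in A -> ~~ connect (color_edge A i) u z ->
    u != z /\ col u z != i.
  move=> uA nuz; have neq: u != z by apply: contraNneq nuz => ->.
  split=> //; apply: contra nuz => ui.
  by apply: connect1; rewrite color_edgeE uA zA neq.
have [xz xzi] := outside x xA nxz.
have x1A : x1 \in A by case/and4P: e.
have [x1z x1zi] := outside x1 x1A nx1z.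
have /and4P[_ _ xx1 /eqP xx1i] := e.
rewrite -(IH x1) //.
case: (rf x x1 z xx1 x1z xz); rewrite ?xx1i // => E.
  by rewrite -E eqxx in x1zi.
by rewrite -E eqxx in xzi.
Qed.

Definition disconnected (A : {set T}) (i : K) := exists x y,
  [/\ x \in A, y \in A & ~~ connect (color_edge A i) x y].

Lemma isolated_disconnected A l v : v \in A -> l \in used A ->
  (forall s, s \in A -> s != v -> col v s != l) -> disconnected A l.
Proof.
move=> vA /usedP[x [y /and4P[xA yA xy /eqP xyl]]] iso.
have [s [sA sv]] : exists s, s \in A /\ s != v.
  by case: (eqVneq x v) => [xv|]; [exists y; rewrite -xv eq_sym | exists x].
exists v, s; split=> //; apply: contra sv => /connectP[[|t p] /=].
  by move=> _ ->.
case/andP=> /and4P[_ tA vt /eqP vtl] _ _.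
by have:= iso t tA; rewrite eq_sym vt vtl eqxx => /(_ isT).
Qed.

(** Induction on the number of vertices, removing a vertex [v]. If the rest [B]
    has a disconnected color [i], this color stays disconnected unless [v] has
    an edge of color [i] into each component of [B]; in that case the edges at
    [v] have at most one color besides [i], and [v] is isolated in any third
    color. If [B] has only two colors, all edges of some new color [l] meet [v],
    so that color [l] is disconnected unless it contains all edges at [v], and
    then [v] is isolated in every other color. *)
Lemma rainbow_free_disconnected A : rainbow_free -> 2 < #|used A| ->
  exists2 i, i \in used A & disconnected A i.
Proof.
move=> rf; have [m] := ubnP #|A|; elim: m A => // m IH A ltAm A3.
have other i j : exists l, [/\ l \in used A, l != i & l != j].
  have: 0 < #|used A :\: [set i; j]|.
    have le2 : #|used A :&: [set i; j]| <= 2.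
      apply: leq_trans (subset_leq_card (subsetIr _ _)) _.
      by rewrite cards2; case: (i != j).
    by have := cardsID [set i; j] (used A); lia.
  case/card_gt0P=> l; rewrite in_setD in_set2 negb_or => /andP[/andP[li lj] lA].
  by exists l.
have [v vA] : exists v, v \in A.
  have /card_gt0P[i /usedP[x [y /and4P[xA _ _ _]]]] : 0 < #|used A| by lia.
  by exists x.
pose B := A :\ v.
have inB s : (s \in B) = (s != v) && (s \in A) by rewrite !inE.
have BA : B \subset A by apply: subD1set.
have usedBA : used B \subset used A.
  apply/subsetP=> i /usedP[x [y /and4P[xB yB xy xyi]]].
  apply/usedP; exists x, y.
  by rewrite color_edgeE xy xyi !(subsetP BA).
have [B3|B2] := ltnP 2 #|used B|; last first.
  (* Here [l] is a color that occurs only at [v]. *)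
  have [l lA lB] : exists2 l, l \in used A & l \notin used B.
    apply/subsetPn; apply: contraTN A3 => sAB.
    by rewrite -leqNgt (leq_trans (subset_leq_card sAB)).
  have star x y : x \in A -> y \in A -> x != y -> x != v -> y != v ->
      col x y != l.
    move=> xA yA xy xv yv; apply: contra lB => xyl.
    by apply/usedP; exists x, y; rewrite color_edgeE !inB xA yA xy xv yv.
  have [/forallP full|/forallPn[a]] :=
      boolP [forall a, (a \in B) ==> (col v a == l)].
    have [j [jA jl _]] := other l l.
    exists j => //; apply: (isolated_disconnected vA jA) => s sA sv.
    have /implyP := full s; rewrite inB sA sv => /(_ isT) /eqP ->.
    by rewrite eq_sym.
  rewrite negb_imply inB => /andP[/andP[av aA] val].
  exists l => //; apply: (isolated_disconnected aA lA) => s sA sa.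
  have [->|sv] := eqVneq s v; first by rewrite col_sym.
  by apply: star; rewrite // eq_sym.
have [|i iB [x0 [y0 [x0B y0B nxy]]]] := IH B _ B3.
  by have:= cardsD1 v A; rewrite vA -/B; lia.
have iA := subsetP usedBA i iB.
pose conn := connect (color_edge B i).
have conn_sym : symmetric conn by apply: connect_color_sym.
have uni s t z : s \in B -> z \in B -> conn s t -> ~~ conn s z ->
    col s z = col t z.
  exact: connect_color_uniform.
have [/forallP touch|/forallPn[s]] := boolP [forall s, (s \in B) ==>
    [exists u, conn s u && (col v u == i)]]; last first.
  rewrite negb_imply => /andP[sB /existsPn nos].
  exists i => //; exists s, v; split=> //; first exact: (subsetP BA).
  suff /closed_connect cl : closed (color_edge A i) [pred u | conn s u].
    apply/negP => /cl; rewrite !inE /conn connect0 => /esym sv.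
    by have:= connect_color_in sv; rewrite sB inB eqxx.
  apply: (intro_closed (connect_color_sym A i)) => u w e; rewrite !inE => su.
  apply: connect_trans (su) _; apply: connect1.
  have /and4P[uA wA uw /eqP uwi] := e.
  have uB : u \in B by rewrite -(connect_color_in su).
  rewrite color_edgeE uB uw uwi eqxx inB wA !andbT /=.
  apply/eqP=> wv; have:= nos u; rewrite su.
  by rewrite col_sym -wv uwi eqxx.
have {}touch s : s \in B -> exists u, [/\ u \in B, conn s u & col v u = i].
  move=> sB; have /implyP/(_ sB)/existsP[u /andP[su /eqP ui]] := touch s.
  by exists u; rewrite -(connect_color_in su).
have [/forallP full|/forallPn[a]] :=
    boolP [forall a, (a \in B) ==> (col v a == i)].
  have [j [jA ji _]] := other i i.
  exists j => //; apply: (isolated_disconnected vA jA) => s sA sv.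
  have /implyP := full s; rewrite inB sA sv => /(_ isT) /eqP ->.
  by rewrite eq_sym.
rewrite negb_imply => /andP[aB vai].
have [l [lA li lj]] := other i (col v a).
exists l => //; apply: (isolated_disconnected vA lA) => b bA bv.
have bB : b \in B by rewrite inB bv.
apply/eqP => vbl.
have vNB s : s \in B -> v != s by rewrite inB eq_sym => /andP[].
(* If [u] is an [i]-neighbor of [v] in another component than [s], the triangle
   [v], [s], [u] forces the color of [s u] to be that of [v s]. *)
have far s u : s \in B -> u \in B -> ~~ conn s u -> col v u = i ->
    col v s != i -> col s u = col v s.
  move=> sB uB nsu vu vs.
  have su : s != u by apply: contraNneq nsu => ->; apply: connect0.
  have sui : col s u != i.
    by apply: contra nsu => sui; apply: connect1; rewrite color_edgeE sB uB su.
  case: (rf v s u (vNB _ sB) su (vNB _ uB)) => [-> //|E|E].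
    by rewrite E vu eqxx in vs.
  by rewrite E vu eqxx in sui.
have vbi : col v b != i by rewrite vbl.
(* An [i]-neighbor [u] of [v] outside the component of [a] and [b] would see
   these two vertices in the different colors of [v a] and [v b]. *)
have [cab|ncab] := boolP (conn a b).
  have [s sB nas] : exists2 s, s \in B & ~~ conn a s.
    have [cx|ncx] := boolP (conn a x0); last by exists x0.
    exists y0 => //; apply: contra nxy => cy.
    by apply: connect_trans cy; rewrite -/conn conn_sym.
  have [u [uB su vu]] := touch s sB.
  have nau : ~~ conn a u.
    by apply: contra nas => au; apply: connect_trans au _;
       rewrite -/conn conn_sym.
  have nbu : ~~ conn b u.
    by apply: contra nau; apply: connect_trans.
  by move: lj; rewrite -vbl -(far a u) // -(far b u) // (uni a b) ?eqxx.
(* Otherwise the unique color between the components of [a] and [b] would be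
   both that of [v a] and that of [v b]. *)
have [u [uB bu vu]] := touch b bB.
have [w [wB aw vw]] := touch a aB.
have nau : ~~ conn a u.
  by apply: contra ncab => au; apply: connect_trans au _;
       rewrite -/conn conn_sym.
have nba : ~~ conn b a by rewrite conn_sym.
have nbw : ~~ conn b w.
  by apply: contra nba => bw; apply: connect_trans bw _;
     rewrite -/conn conn_sym.
move: lj; rewrite -vbl -(far a u) // -(far b w) //.
rewrite (col_sym b w) -(uni a w b) // (col_sym a u).
by rewrite -(uni b u a) // col_sym eqxx.
Qed.

Definition module (A C : {set T}) := forall x y z,
  x \in C -> y \in C -> z \in A :\: C -> col x z = col y z.

Definition decomposable (A : {set T}) := exists C : {set T},
  [/\ module A C, C \subset A, 1 < #|C| & #|C| < #|A|].

Lemma three_colors_decomposable A : rainbow_free -> 2 < #|used A| ->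
  decomposable A.
Proof.
move=> rf A3.
have [i /usedP[a [b ab]] [x [y [xA yA nxy]]]] :=
  rainbow_free_disconnected rf A3.
have /and4P[aA bA a_b abi] := ab.
pose C := [set u in A | connect (color_edge A i) a u].
have Cconn u w : u \in C -> w \in C -> connect (color_edge A i) u w.
  rewrite !inE => /andP[_ au] /andP[_ aw].
  by apply: connect_trans aw; rewrite connect_color_sym.
have CA : C \subset A by apply/subsetP=> u; rewrite inE => /andP[].
exists C; split=> //.
- move=> u w z uC wC; rewrite inE => /andP[zC zA].
  apply: (connect_color_uniform (A := A) (i := i)) => //.
  + exact: (subsetP CA).
  + exact: Cconn.
  + apply: contra zC => uz; rewrite inE zA.
    by move: uC; rewrite inE => /andP[_ au]; apply: connect_trans au uz.
- apply/card_gt1P; exists a, b.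
  by split; rewrite // !inE ?aA ?bA ?connect0 ?(connect1 ab).
- apply: proper_card; rewrite properEneq CA andbT.
  apply: contraNneq nxy => CeqA.
  by apply: Cconn; rewrite CeqA.
Qed.

(** * Colorings with two colors *)

Definition two_colored (A : {set T}) (p q : K) := forall x y,
  x \in A -> y \in A -> x != y -> col x y = p \/ col x y = q.

Definition path4 (A : {set T}) := exists (a b c d : T) (p q : K),
  [/\ A = [set a; b; c; d], uniq [:: a; b; c; d],
      [/\ col a b = p, col b c = p & col c d = p] &
      [/\ col a c = q, col a d = q & col b d = q]].

Lemma triangle_decomposable A : rainbow_free -> #|A| = 3 -> decomposable A.
Proof.
move=> rf A3; have [a [b [c [eA ab bc ac]]]] := cards3_set A3.
have pair u w z : A = [set u; w; z] -> u != w -> col u z = col w z ->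
    decomposable A.
  move=> eA' uw uwz; exists [set u; w]; rewrite cards2 uw A3; split=> //.
    move=> x y t; rewrite eA' !inE negb_or.
    by do 2![case/orP=> /eqP->]; case/andP=> /andP[/negPf-> /negPf->] /eqP->.
  by rewrite eA' subsetUl.
case: (rf a b c ab bc ac) => E.
- apply: (pair a c b); rewrite ?(col_sym c) //.
  by rewrite eA setUAC.
- apply: (pair b c a); rewrite // ?(col_sym b) ?(col_sym c) //.
  by rewrite eA -setUA setUC.
- by apply: (pair a b c).
Qed.

Local Ltac by_arrangement arrange lem l :=
  solve [apply: (lem _ _ _ _ (arrange l isT)); rewrite /=; congruence].

(** Case analysis on the colors of the six edges: some pair or some triple of
    vertices is a module, unless one of the twelve paths through the four
    vertices is monochromatic with a monochromatic complement. *)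
Lemma square_decomposable A p q : #|A| = 4 -> two_colored A p q ->
  decomposable A \/ path4 A.
Proof.
move=> A4 A2.
have [s us sA] : exists2 s, uniq s & A =i s.
  by exists (enum A); [apply: enum_uniq | move=> x; rewrite mem_enum].
have s4 : size s = 4 by rewrite -A4 (eq_card sA); apply/esym/card_uniqP.
case: s us sA s4 => [|a [|b [|c [|d [|]]]]] // us sA _.
pose Q s := uniq s /\ A =i s.
have Qp s t : perm_eq s t -> Q s -> Q t.
  move=> e [u m]; split; first by rewrite -(perm_uniq e).
  by move=> x; rewrite m; apply: perm_mem.
have pair x y z t : Q [:: x; y; z; t] -> col x z = col y z ->
    col x t = col y t -> decomposable A.
  case=> u m e1 e2; move: u; rewrite /= !inE !negb_or.
  case/and4P=> /and3P[xy xz xt] /andP[yz yt] zt _.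
  exists [set x; y]; rewrite cards2 xy A4; split=> //.
    move=> v w r; rewrite !inE m !inE negb_or.
    do 2![case/orP=> /eqP->]; case/andP=> /andP[/negPf-> /negPf->] /=;
      by case/orP=> /eqP->.
  by apply/subsetP=> v; rewrite m !inE orbA => ->.
have triple x y z t : Q [:: x; y; z; t] -> col x t = col y t ->
    col y t = col z t -> decomposable A.
  case=> u m e1 e2; move: u; rewrite /= !inE !negb_or.
  case/and4P=> /and3P[xy xz xt] /andP[yz yt] zt _.
  exists [set x; y; z]; rewrite A4 setUC cardsU1 cards2 !inE negb_or xy.
  rewrite eq_sym xz eq_sym yz; split=> //.
    move=> v w r; rewrite !inE m !inE !negb_or.
    do 2![case/or3P=> /eqP->]; case/andP=> /and3P[/negPf-> /negPf-> /negPf->] /=;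
      by move/eqP->; rewrite ?e1 ?e2.
  by apply/subsetP=> v; rewrite m !inE; do 3![case: (v == _)].
have mono_path x y z t : Q [:: x; y; z; t] -> col x y = col y z ->
    col y z = col z t -> col x z = col x t -> col x t = col y t -> path4 A.
  case=> u m e1 e2 e3 e4; exists x, y, z, t, (col x y), (col x z).
  split=> //; last by split; rewrite -?e4.
    by apply/setP=> v; rewrite m !inE -!orbA.
  by split; rewrite -?e1 // e1.
have arrange l : perm_eq [:: 0; 1; 2; 3] l ->
    Q (map (nth a [:: a; b; c; d]) l).
  move=> e; apply: (Qp [:: a; b; c; d]) => //.
  exact: (perm_map (nth a [:: a; b; c; d]) e).
move: (us); rewrite /= !inE !negb_or.
case/and4P=> /and3P[ab ac ad] /andP[bc bd] cd _.
have [aA bA cA dA] : [/\ a \in A, b \in A, c \in A & d \in A].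
  by rewrite !sA !inE !eqxx !orbT.
have [[Eab Eac] [Ead Ebc] [Ebd Ecd]] :
    [/\ col b a = col a b /\ col c a = col a c,
        col d a = col a d /\ col c b = col b c
      & col d b = col b d /\ col d c = col c d].
  by do !split.
(* The arrangements list vertices by their rank in [a; b; c; d]; a module comes
   first, and a path appears in its own order. *)
case: (A2 a b) => // ?; case: (A2 a c) => // ?; case: (A2 a d) => // ?;
case: (A2 b c) => // ?; case: (A2 b d) => // ?; case: (A2 c d) => // ?;
first [ left; first
  [ by_arrangement arrange pair [:: 0; 1; 2; 3]
  | by_arrangement arrange pair [:: 0; 2; 1; 3]
  | by_arrangement arrange pair [:: 0; 3; 1; 2]
  | by_arrangement arrange pair [:: 1; 2; 0; 3]
  | by_arrangement arrange pair [:: 1; 3; 0; 2]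
  | by_arrangement arrange pair [:: 2; 3; 0; 1]
  | by_arrangement arrange triple [:: 0; 1; 2; 3]
  | by_arrangement arrange triple [:: 0; 1; 3; 2]
  | by_arrangement arrange triple [:: 0; 2; 3; 1]
  | by_arrangement arrange triple [:: 1; 2; 3; 0] ]
| right; first
  [ by_arrangement arrange mono_path [:: 0; 1; 2; 3]
  | by_arrangement arrange mono_path [:: 0; 1; 3; 2]
  | by_arrangement arrange mono_path [:: 0; 2; 1; 3]
  | by_arrangement arrange mono_path [:: 0; 2; 3; 1]
  | by_arrangement arrange mono_path [:: 0; 3; 1; 2]
  | by_arrangement arrange mono_path [:: 0; 3; 2; 1]
  | by_arrangement arrange mono_path [:: 1; 0; 2; 3]
  | by_arrangement arrange mono_path [:: 1; 0; 3; 2]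
  | by_arrangement arrange mono_path [:: 1; 2; 0; 3]
  | by_arrangement arrange mono_path [:: 1; 3; 0; 2]
  | by_arrangement arrange mono_path [:: 2; 0; 1; 3]
  | by_arrangement arrange mono_path [:: 2; 1; 0; 3] ] ].
Qed.

(** * Weighted cliques and substitution *)

(** The elements of [F] are the bags; color [i] belongs to the bags in [E i]. *)
Variables (F : finType) (E : K -> {set F}).

Definition clique (f : F) (B : {set T}) :=
  [forall x in B, forall y in B, (x != y) ==> (f \in E (col x y))].

Lemma cliqueP f B : reflect
  (forall x y, x \in B -> y \in B -> x != y -> f \in E (col x y)) (clique f B).
Proof.
apply: (iffP forall_inP) => [h x y xB yB xy|h x xB].
  by have /forall_inP/(_ y yB)/implyP := h x xB; apply.
by apply/forall_inP => y yB; apply/implyP; apply: h.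
Qed.

Definition clique_weight (A : {set T}) (w : T -> F -> nat) (f : F) :=
  \max_(B : {set T} | (B \subset A) && clique f B) \sum_(v in B) w v f.

Lemma clique_weight_ge A w f B : B \subset A -> clique f B ->
  \sum_(v in B) w v f <= clique_weight A w f.
Proof.
move=> BA cB; apply: (@leq_bigmax_cond _ _ (fun B => \sum_(v in B) w v f)).
by rewrite BA.
Qed.

Lemma clique_weight_attained A w f : exists B : {set T},
  [/\ B \subset A, clique f B & clique_weight A w f = \sum_(v in B) w v f].
Proof.
pose D := [pred B : {set T} | (B \subset A) && clique f B].
have D0 : 0 < #|D|.
  apply/card_gt0P; exists set0; rewrite inE sub0set.
  by apply/cliqueP => x y; rewrite inE.
have [B /andP[BA cB] eB] :=
  eq_bigmax_cond (fun B : {set T} => \sum_(v in B) w v f) D0.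
by exists B; split.
Qed.

Lemma clique1 f x : clique f [set x].
Proof. by apply/cliqueP=> u v /set1P-> /set1P->; rewrite eqxx. Qed.

Lemma clique2 f x y : f \in E (col x y) -> clique f [set x; y].
Proof.
move=> h; apply/cliqueP=> u v /set2P[]-> /set2P[]->; rewrite ?eqxx // => _.
by rewrite col_sym.
Qed.

Lemma leq_clique_weight A w f v : v \in A -> w v f <= clique_weight A w f.
Proof.
move=> vA; have -> : w v f = \sum_(z in [set v]) w z f by rewrite big_set1.
by apply: clique_weight_ge; rewrite ?sub1set // clique1.
Qed.

Lemma leq_clique_weight2 A w f u v : u \in A -> v \in A -> u != v ->
  f \in E (col u v) -> w u f + w v f <= clique_weight A w f.
Proof.
move=> uA vA uv fuv.
have -> : w u f + w v f = \sum_(z in [set u; v]) w z f.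
  by rewrite big_setU1 ?inE //= big_set1.
by apply: clique_weight_ge; [rewrite subUset !sub1set uA | apply: clique2].
Qed.

(** When every edge of [A] lies in exactly one of two bags, the cliques of one bag
    are the stable sets of the other, and for this pair of bags the inequality
    is the one that weighted cliques and stable sets satisfy in perfect
    graphs. *)
Definition balanced (A : {set T}) (w : T -> F -> nat) (G : {set F}) :=
  \sum_(v in A) \prod_(f in G) w v f <= \prod_(f in G) clique_weight A w f.

Lemma balanced_clique A w f : clique f A -> balanced A w [set f].
Proof.
move=> cA; rewrite /balanced big_set1.
by under eq_bigr do rewrite big_set1; apply: clique_weight_ge.
Qed.

(** The numbers [n v] stand for square roots of products of weights: they are
    only required to satisfy [n v ^ 2 <= \prod_f w v f], which avoids roots and
    lets [n v] be the size of a set of vertices that [v] replaces. Unit weights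
    give the bound on [#|A|]. *)
Definition bounded (A : {set T}) := forall (w : T -> F -> nat) (n : T -> nat),
  (forall v, v \in A -> n v ^ 2 <= \prod_f w v f) ->
  (\sum_(v in A) n v) ^ 2 <= \prod_f clique_weight A w f.

(** Bags outside [G] and [H] contribute at most their maximum clique weight for
    each vertex; the two remaining factors are summed by Cauchy-Schwarz. *)
Lemma bounded_balanced (A : {set T}) (G H : {set F}) : [disjoint G & H] ->
  (forall w, balanced A w G) -> (forall w, balanced A w H) -> bounded A.
Proof.
move=> GH bG bH w n nw.
have split_prod (g : F -> nat) : \prod_f g f =
    (\prod_(f in ~: (G :|: H)) g f) *
      ((\prod_(f in G) g f) * (\prod_(f in H) g f)).
  rewrite mulnC -bigU //= (bigID [in G :|: H]) /=; congr (_ * _).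
    by apply: eq_bigl => f; rewrite !inE.
  by apply: eq_bigl => f; rewrite !inE.
rewrite split_prod.
apply: leq_trans (leq_mul (leqnn _) (leq_mul (bG w) (bH w))).
apply: cauchy_schwarz_sum => v vA.
apply: leq_trans (nw v vA) _; rewrite split_prod.
apply: leq_mul => //; apply: leq_prod => f _.
exact: leq_clique_weight.
Qed.

Hypothesis two_bags : forall i, #|E i| = 2.

Lemma monochromatic_bounded (A : {set T}) i :
  (forall x y, x \in A -> y \in A -> x != y -> col x y = i) -> bounded A.
Proof.
move=> Ai; have /eqP/cards2P[f [g [fg Efg]]] := two_bags i.
have cA h : h \in E i -> forall w, balanced A w [set h].
  move=> hi w; apply: balanced_clique; apply/cliqueP => x y xA yA xy.
  by rewrite (Ai x y).
apply: (@bounded_balanced A [set f] [set g]); first by rewrite disjoints1 inE.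
  by apply: cA; rewrite Efg set21.
by apply: cA; rewrite Efg set22.
Qed.

Lemma card_le2_bounded (A : {set T}) : #|A| <= 2 -> bounded A.
Proof.
move=> A2.
have [->|[a aA]] := set_0Vmem A; first by move=> w n _; rewrite big_set0.
have [B1|] := posnP #|A :\ a|.
  apply: (@monochromatic_bounded _ (col a a)) => x y xA yA xy.
  have only z : z \in A -> z = a.
    move=> zA; apply/eqP; move/cards0_eq/setP/(_ z): B1.
    by rewrite !inE zA andbT => /negbFE.
  by rewrite (only x) // (only y).
case/card_gt0P=> b /setD1P[ba bA].
have eA : [set a; b] = A.
  apply/eqP; rewrite eqEcard subUset !sub1set aA bA /=.
  by rewrite cards2 eq_sym ba.
apply: (@monochromatic_bounded _ (col a b)) => x y; rewrite -eA.
by move=> /set2P[]-> /set2P[]->; rewrite ?eqxx.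
Qed.

(** Each bag of the path color [p] is paired with a bag of the complementary
    color [q]. When both are the same bag, the whole of [A] is a clique of it;
    otherwise the pair is balanced because the path is perfect. *)
Lemma path4_bounded A : path4 A -> bounded A.
Proof.
case=> a [b [c [d [p [q [eA u [ab bc cd] [ac ad bd]]]]]]].
move: u; rewrite /= !inE !negb_or.
case/and4P=> /and3P[nab nac nad] /andP[nbc nbd] ncd _.
have [aA bA cA dA] : [/\ a \in A, b \in A, c \in A & d \in A].
  by rewrite eA !inE !eqxx !orbT.
have sumA (n : T -> nat) : \sum_(v in A) n v = n a + n b + n c + n d.
  rewrite eA -!setUA !big_setU1 ?inE ?negb_or ?nab ?nac ?nad ?nbc ?nbd //=.
  by rewrite big_set1 !addnA.
have bal f g : f \in E p -> g \in E q -> forall w, balanced A w [set f; g].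
  move=> fp gq w; have [efg|nfg] := eqVneq f g.
    rewrite efg setUid; apply: balanced_clique; apply/cliqueP=> x y.
    rewrite -efg in gq *.
    have fsym s t : f \in E (col s t) -> f \in E (col t s) by rewrite col_sym.
    rewrite eA !inE -!orbA.
    by do 2![case/or4P=> /eqP->]; rewrite ?eqxx // => _;
      first [rewrite ?ab ?bc ?cd ?ac ?ad ?bd //; done
            | apply: fsym; rewrite ?ab ?bc ?cd ?ac ?ad ?bd //; done].
  rewrite /balanced !big_setU1 ?inE // big_set1.
  under eq_bigr do rewrite big_setU1 ?inE //= big_set1.
  rewrite sumA /=; apply: path4_perfect;
    by apply: leq_clique_weight2; rewrite // ?ab ?bc ?cd ?ac ?ad ?bd.
have /eqP/cards2P[f1 [f2 [nf Ep]]] := two_bags p.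
have /eqP/cards2P[g1 [g2 [ng Eq]]] := two_bags q.
have [f1p f2p] : f1 \in E p /\ f2 \in E p by rewrite Ep set21 set22.
have [g1q g2q] : g1 \in E q /\ g2 \in E q by rewrite Eq set21 set22.
have disj f g f' g' : f != f' -> g != g' -> f != g' -> g != f' ->
    [disjoint [set f; g] & [set f'; g']].
  move=> h1 h2 h3 h4; rewrite disjoints_subset subUset !sub1set !inE !negb_or.
  by rewrite h1 h2 h3 h4.
(* One of the two ways to match the bags of [p] with those of [q] yields
   disjoint pairs, also when the colors share one bag or both. *)
have [ok|] := boolP ((f1 != g2) && (f2 != g1)).
  case/andP: ok => ok1 ok2.
  apply: (@bounded_balanced A [set f1; g1] [set f2; g2]); try exact: bal.
  by apply: disj; rewrite // eq_sym.
move=> clash.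
apply: (@bounded_balanced A [set f1; g2] [set f2; g1]); try exact: bal.
apply: disj => //; first by rewrite eq_sym.
  apply/eqP => e; case/nandP: clash => /negPn/eqP x;
  by move/eqP: nf; move/eqP: ng; congruence.
apply/eqP => e; case/nandP: clash => /negPn/eqP x;
by move/eqP: nf; move/eqP: ng; congruence.
Qed.

(** A clique of the quotient that contains [c] becomes a clique of [A] of the
    same weight when [c] is replaced by a heaviest clique of [C]. *)
Lemma module_bounded A C c : module A C -> C \subset A -> c \in C ->
  bounded C -> bounded (c |: (A :\: C)) -> bounded A.
Proof.
move=> modC CA cC bC bA' w n nw.
pose w' v f := if v == c then clique_weight C w f else w v f.
pose n' v := if v == c then \sum_(u in C) n u else n v.
have cAC : c \notin A :\: C by rewrite inE cC.
have notc v : v \in A :\: C -> (v == c) = false.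
  by move=> vAC; apply: contraNF cAC => /eqP <-.
have sumA : \sum_(v in A) n v = \sum_(v in c |: (A :\: C)) n' v.
  rewrite big_setU1 //= {1}/n' eqxx (big_setID C) /= (setIidPr CA).
  by congr (_ + _); apply: eq_bigr => v vAC; rewrite /n' notc.
rewrite sumA; apply: leq_trans (bA' w' n' _) _.
  move=> v; rewrite in_setU1 /n' /w' => /orP[/eqP->|vAC].
    by rewrite eqxx; apply: bC => u uC; apply: nw; apply: (subsetP CA).
  by rewrite notc //; apply: nw; move: vAC; rewrite inE => /andP[].
apply: leq_prod => f _.
have [B [BA' /cliqueP cB ->]] := clique_weight_attained (c |: (A :\: C)) w' f.
have outC v : v \in B -> v != c -> v \in A :\: C.
  by move=> vB vc; have := subsetP BA' v vB; rewrite in_setU1 (negPf vc).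
have [cinB|cnotB] := boolP (c \in B); last first.
  have vc v : v \in B -> v != c by apply: contraTneq => ->.
  rewrite (eq_bigr (fun v => w v f)); last first.
    by move=> v vB; rewrite /w' (negPf (vc v vB)).
  apply: clique_weight_ge; last exact/cliqueP.
  by apply/subsetP=> v vB; have := outC v vB (vc v vB); rewrite inE => /andP[].
have [D [DC /cliqueP cD eD]] := clique_weight_attained C w f.
have outB v : v \in B :\ c -> v \in A :\: C.
  by case/setD1P=> vc vB; apply: outC.
have DB : [disjoint D & B :\ c].
  rewrite disjoints_subset; apply/subsetP=> v vD; rewrite inE.
  by apply/negP=> /outB; rewrite inE (subsetP DC).
have -> : \sum_(v in B) w' v f = \sum_(v in D :|: (B :\ c)) w v f.
  rewrite [RHS](eq_bigl [in [predU D & B :\ c]]); last first.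
    by move=> v; rewrite !inE.
  rewrite bigU // (big_setD1 c cinB) /= {1}/w' eqxx eD; congr (_ + _).
  by apply: eq_bigr => v vB; rewrite /w' notc ?outB.
apply: clique_weight_ge.
  rewrite subUset (subset_trans DC CA); apply/subsetP=> v /outB.
  by rewrite inE => /andP[].
have mixed x y : x \in D -> y \in B :\ c -> f \in E (col x y).
  move=> xD yB; have [yc yinB] := setD1P yB.
  rewrite (modC x c y (subsetP DC x xD) cC (outB y yB)).
  by apply: cB; rewrite // eq_sym.
apply/cliqueP=> x y /setUP[xD|xB] /setUP[yD|yB] xy.
- exact: cD.
- exact: mixed.
- by rewrite col_sym; apply: mixed.
- by case/setD1P: xB => _ xB; case/setD1P: yB => _ yB; apply: cB.
Qed.

(** * The product bound for Gallai colorings *)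

Hypothesis rf : rainbow_free.
Hypothesis no_two_colored5 : forall A p q, #|A| = 5 -> ~ two_colored A p q.

Lemma two_colored_used A : 0 < #|A| -> #|used A| <= 2 ->
  exists p q, two_colored A p q.
Proof.
case/card_gt0P=> a _ /(subset_pair (col a a))[p [q /subsetP sub]].
exists p, q => x y xA yA xy.
have /sub/set2P[] : col x y \in used A; [|by left|by right].
by apply/usedP; exists x, y; rewrite color_edgeE xA yA xy eqxx.
Qed.

Lemma decomposable_or_path4 A : 2 < #|A| -> decomposable A \/ path4 A.
Proof.
move=> A3; have [u3|u2] := ltnP 2 #|used A|.
  by left; apply: three_colors_decomposable.
have [//|p [q Apq]] := two_colored_used _ u2; first exact: leq_trans A3.
have [A5|] := leqP 5 #|A|.
  have [s [us s5 sA]] := card_geqP A5.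
  have [] := @no_two_colored5 [set x in s] p q.
    by rewrite cardsE (card_uniqP us).
  by move=> x y; rewrite !inE => /sA xA /sA yA; apply: Apq.
rewrite ltnS leq_eqVlt => /orP[/eqP A4|A4].
  exact: square_decomposable A4 Apq.
left; apply: triangle_decomposable => //.
by apply/eqP; rewrite eqn_leq A3 -ltnS A4.
Qed.

Lemma rainbow_free_bounded A : bounded A.
Proof.
have [m] := ubnP #|A|; elim: m A => // m IH A ltAm.
have [/card_le2_bounded//|A3] := leqP #|A| 2.
have [[C [modC CA C2 ltCA]]|] := decomposable_or_path4 A3; last first.
  exact: path4_bounded.
have [c cC] : exists c, c \in C by apply/card_gt0P/ltnW.
apply: (module_bounded modC CA cC); apply: IH.
  exact: leq_trans ltCA _.
by rewrite cardsU1 inE cC /=; have := cardsID C A; rewrite (setIidPr CA); lia.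
Qed.

End Coloring.

(** * From edge colorings to symmetric color functions *)

Section EdgeColoring.
Variables (n k : nat) (c : edge n -> 'I_k) (i0 : 'I_k).

(** The value [i0] is only taken on the diagonal, where [[set x; x]] is not an
    edge. *)
Definition pair_color (x y : 'I_n) : 'I_k :=
  if insub [set x; y] is Some e then c e else i0.

Lemma pair_color_sym x y : pair_color x y = pair_color y x.
Proof. by rewrite /pair_color setUC. Qed.

Lemma pair_colorE x y : x != y ->
  exists2 e : edge n, val e = [set x; y] & pair_color x y = c e.
Proof.
move=> xy; rewrite /pair_color; case: insubP => [e _ ve|]; first by exists e.
by rewrite cards2 xy.
Qed.

Lemma pair_color_on (A : {set 'I_n}) x y : x \in A -> y \in A -> x != y ->
  pair_color x y \in colors_on c A.
Proof.
move=> xA yA /pair_colorE[e ve ->]; apply/imsetP; exists e => //.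
by rewrite inE ve subUset !sub1set xA.
Qed.

Lemma colors_onP (A : {set 'I_n}) i : reflect
  (exists x y, [/\ x \in A, y \in A, x != y & pair_color x y = i])
  (i \in colors_on c A).
Proof.
apply: (iffP imsetP) => [[e eA ->]|[x [y [xA yA xy <-]]]].
  have /cards2P[x [y [xy ve]]] := valP e.
  move: eA; rewrite inE ve subUset !sub1set => /andP[xA yA].
  exists x, y; split=> //; have [e' ve' ->] := pair_colorE xy.
  by congr c; apply: val_inj; rewrite ve.
exact/imsetP/pair_color_on.
Qed.

Lemma gallai_rainbow_free : gallai_coloring c -> rainbow_free pair_color.
Proof.
move=> gal x y z xy yz xz.
have T3 : #|[set x; y; z]| = 3.
  by rewrite setUC cardsU1 cards2 !inE negb_or xy eq_sym xz eq_sym yz.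
have [|e1] := eqVneq (pair_color x y) (pair_color y z); first by constructor 1.
have [|e2] := eqVneq (pair_color x y) (pair_color x z); first by constructor 2.
have [|e3] := eqVneq (pair_color y z) (pair_color x z); first by constructor 3.
have := gal _ T3; rewrite leqNgt => /card_gt2P[].
exists (pair_color x y), (pair_color y z), (pair_color x z).
by split; split; rewrite // 1?eq_sym // pair_color_on // !inE eqxx ?orbT.
Qed.

End EdgeColoring.

Lemma rainbow_free_gallai n k (c : edge n -> 'I_k) i0 :
  rainbow_free (pair_color c i0) -> gallai_coloring c.
Proof.
move=> rf T /cards3_set[x [y [z [eT xy yz xz]]]].
have sub : colors_on c T \subset
    [set pair_color c i0 x y; pair_color c i0 y z; pair_color c i0 x z].
  apply/subsetP=> i /(colors_onP _ i0)[u [v [uT vT uv <-]]].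
  move: uT vT uv; rewrite eT !inE -!orbA.
  by do 2![case/or3P=> /eqP->]; rewrite ?eqxx // => _;
    rewrite ?(pair_color_sym _ _ y x) ?(pair_color_sym _ _ z x)
      ?(pair_color_sym _ _ z y) ?eqxx ?orbT.
apply: leq_trans (subset_leq_card sub) _.
have le2 (a b : 'I_k) : #|[set a; b]| <= 2 by rewrite cards2; case: (_ != _).
case: (rf x y z xy yz xz) => ->.
- by rewrite setUid.
- by rewrite setUAC setUid.
- by rewrite -setUA setUid.
Qed.

(** * The two bounds *)

Lemma ordS_neq k (i : 'I_k) : 1 < k -> i != ordS i.
Proof.
move=> k1; apply/eqP => /(congr1 val) /=; have := ltn_ord i.
rewrite leq_eqVlt => /orP[/eqP ik|ik]; last by rewrite modn_small //; lia.
by rewrite ik modnn; lia.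
Qed.

Lemma gallai_arrow_pow k : 1 < k -> gallai_arrow k 2 5 (2 ^ k + 1).
Proof.
move=> k1 c gal.
have i0 : 'I_k by apply: Ordinal (ltnW k1).
case: (boolP [exists A : {set 'I_(2 ^ k + 1)},
    (#|A| == 5) && (#|colors_on c A| <= 2)]) => [/existsP[A /andP[/eqP A5 A2]]|].
  by exists A.
move/existsPn=> none; exfalso.
pose col := pair_color c i0.
have no5 (A : {set 'I_(2 ^ k + 1)}) p q : #|A| = 5 -> ~ two_colored col A p q.
  move=> A5 Apq; have := none A; rewrite A5 eqxx /= => /negP; apply.
  apply: leq_trans (_ : #|[set p; q]| <= 2);
    last by rewrite cards2; case: (_ != _).
  apply/subset_leq_card/subsetP => i /(colors_onP _ i0)[x [y [xA yA xy <-]]].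
  by have [] := Apq x y xA yA xy; rewrite /col => ->; rewrite !inE eqxx ?orbT.
(* Color [i] is in the bags [i] and [i + 1] modulo [k], so that bag [f] holds
   the colors [f] and [f - 1]. *)
pose E (i : 'I_k) := [set i; ordS i].
have two_bags i : #|E i| = 2 by rewrite cards2 ordS_neq.
have bound : (\sum_(v in [set: 'I_(2 ^ k + 1)]) 1) ^ 2 <=
    \prod_(f < k) clique_weight col E setT (fun _ _ => 1) f.
  apply: (rainbow_free_bounded (pair_color_sym c i0) two_bags
            (gallai_rainbow_free i0 gal) no5) => v _.
  by rewrite prod_nat_const !exp1n.
move: bound; rewrite sum1_card cardsT card_ord.
rewrite leqNgt => /negP; apply.
apply: (@leq_ltn_trans (\prod_(f < k) 4)); last first.
  rewrite prod_nat_const card_ord -[4]/(2 ^ 2) -expnM mulnC expnM.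
  by rewrite ltn_sqr addn1.
apply: leq_prod => f _.
have [B [_ /cliqueP cB ->]] := clique_weight_attained col E setT (fun _ _ => 1) f.
rewrite sum1_card leqNgt; apply/negP => /card_geqP[s [us s5 sB]].
apply: (no5 [set x in s] f (ord_pred f)); first by rewrite cardsE (card_uniqP us).
move=> x y; rewrite !inE => /sB xB /sB yB xy.
by have /set2P[->|->] := cB x y xB yB xy; [left | right; rewrite ordSK].
Qed.

(** Only the injection of the vertices into bit vectors matters, so it is taken
    from a comparison of cardinals rather than from binary expansions. *)
Lemma bit_coloring n k : 0 < k -> n <= 2 ^ k -> exists c : edge n -> 'I_k,
  gallai_coloring c /\ forall A : {set 'I_n}, #|A| = 5 -> 2 < #|colors_on c A|.
Proof.
move=> k0 nk; have i0 : 'I_k by apply: Ordinal k0.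
have n_bits : n <= #|{ffun 'I_k -> bool}| by rewrite card_ffun card_bool card_ord.
pose bit (x : 'I_n) : {ffun 'I_k -> bool} := enum_val (widen_ord n_bits x).
have bit_inj : injective bit.
  by move=> x y /enum_val_inj/(congr1 val)/= xy; apply: val_inj.
have diff x y : x != y -> exists i : 'I_k,
    bit x i != bit y i /\ forall j : 'I_k, j < i -> bit x j = bit y j.
  move=> xy; have [i xyi] : exists i, bit x i != bit y i.
    apply/existsP; apply: contraNT xy => /existsPn same.
    by apply/eqP/bit_inj/ffunP => i; apply/eqP/negPn.
  case: (@arg_minnP _ i (fun j => bit x j != bit y j) val xyi) => j xyj jmin.
  exists j; split=> // l lj; apply/eqP; apply: contraTT lj => /jmin.
  by rewrite -leqNgt.
have [c cP] : exists c : edge n -> 'I_k, forall e x y, val e = [set x; y] ->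
    bit x (c e) != bit y (c e) /\
    forall j : 'I_k, j < c e -> bit x j = bit y j.
  apply: (@fin_all_exists _ (fun=> 'I_k) (fun e i => forall x y,
    val e = [set x; y] -> bit x i != bit y i /\
    forall j : 'I_k, j < i -> bit x j = bit y j)) => e.
  have /cards2P[x [y [xy ve]]] := valP e.
  have [i [xyi low]] := diff x y xy; exists i => u v; rewrite ve => eq.
  have uv : u != v by have := valP e; rewrite ve eq cards2; case: (u != v).
  have /set2P ux : u \in [set x; y] by rewrite eq set21.
  have /set2P vx : v \in [set x; y] by rewrite eq set22.
  case: ux vx uv => -> [] ->; rewrite ?eqxx //= => _; split=> //.
    by rewrite eq_sym.
  by move=> j /low.
have pcP x y : x != y -> bit x (pair_color c i0 x y) != bit y (pair_color c i0 x y)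
    /\ forall j : 'I_k, j < pair_color c i0 x y -> bit x j = bit y j.
  by case/(pair_colorE c i0) => e ve ->; apply: cP.
exists c; split.
  apply: (@rainbow_free_gallai _ _ c i0) => x y z xy yz xz.
  have [dxy lxy] := pcP x y xy; have [dyz lyz] := pcP y z yz.
  have [dxz lxz] := pcP x z xz.
  set a := pair_color c i0 x y in dxy lxy *.
  set b := pair_color c i0 y z in dyz lyz *.
  set d := pair_color c i0 x z in dxz lxz *.
  (* At the smallest of three distinct colors, two of the pairs agree. *)
  have [ab|ab|/val_inj] := ltngtP a b; last by constructor 1.
    have [ad|da|/val_inj] := ltngtP a d; last by constructor 2.
      by rewrite (lxz _ ad) (lyz _ ab) eqxx in dxy.
    by rewrite (lxy _ da) (lyz _ (ltn_trans da ab)) eqxx in dxz.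
  have [bd|db|/val_inj] := ltngtP b d; last by constructor 3.
    by rewrite -(lxy _ ab) (lxz _ bd) eqxx in dyz.
  by rewrite (lxy _ (ltn_trans db ab)) (lyz _ db) eqxx in dxz.
move=> A A5; rewrite ltnNge; apply/negP => /(subset_pair i0)[p [q /subsetP sub]].
have inj : {in A &, injective (fun x => (bit x p, bit x q))}.
  move=> x y xA yA [xyp xyq]; apply/eqP; apply: contraT => xy.
  have [+ _] := pcP x y xy.
  by have /sub/set2P[->|->] := pair_color_on c i0 xA yA xy; rewrite ?xyp ?xyq eqxx.
have := max_card (mem [set (bit x p, bit x q) | x in A]).
by rewrite card_in_imset // A5 card_prod card_bool.
Qed.

Theorem theorem1p11 (k : nat) (hk : 2 <= k) :
  gallai_number k 2 5 (2 ^ k + 1).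
Proof.
split; first by rewrite addn1.
  exact: gallai_arrow_pow.
move=> n _ arrow; rewrite addn1 ltnNge; apply/negP => nk.
have [c [gal no5]] := bit_coloring (ltnW hk) nk.
have [A [A5 A2]] := arrow c gal.
by have := no5 A A5; rewrite ltnNge A2.
Qed.
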